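(* Consider the optimal estimator gain $L_{aug}=\Sigma_{aug}C_{aug}^TW^{-1}$, where $\Sigma_{aug}$ is the unique positive definite solution to the algebraic Riccati equation $$0=A_{aug}\Sigma_{aug}+\Sigma_{aug}A_{aug}^T+V_{aug}-\Sigma_{aug}C_{aug}^TW^{-1}C_{aug}\Sigma_{aug},\qquad V_{aug}=E_{aug}VE_{aug}^T,$$ and let $A_{aug}^{CL}=A_{aug}-L_{aug}C_{aug}$. Define $L=\Sigma C^TW^{-1}$, where $\Sigma$ is the unique positive definite solution to the Riccati equation $$0=A\Sigma+\Sigma A^T-\Sigma C^TW^{-1}C\Sigma+EVE^T .$$ Assume that the eigenvalues of $A_N$, $A$, and $A-LC$ are disjoint. Then $A_{aug}^{CL}$ has (i) $N$ eigenvalues identical to those of $A_N$, and (ii) $n$ eigenvalues identical to those of $A-LC$.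
   Context: Let $n,N\ge1$ be integers, $\tau>0$, $A\in\mathbb{R}^{n\times n}$, $B,E\in\mathbb{R}^{n\times1}$, $C\in\mathbb{R}^{1\times n}$, with $(A,C)$ observable and $(A,B)$, $(A,E)$ controllable. $V\ge0$ and $W>0$ are real scalars (covariances of the zero-mean Gaussian white process disturbance and measurement noise). $P_N(s)$ denotes the $N$-th order (diagonal) Padé approximation of $e^{-s\tau}$: $P_N(s)=Q_N(-s)/Q_N(s)$ with $Q_N(s)=\sum_{k=0}^N\frac{(2N-k)!\,N!}{(2N)!\,k!\,(N-k)!}(\tau s)^k$. It has $N$ zeros in the open right half plane and $N$ distinct poles, located at the negatives of those zeros, and it is allpass: $P_N(s)P_N(-s)=1$. $(A_N,B_N,C_N,D_N)$ is a minimal real realization, $P_N(s)=C_N(sI_N-A_N)^{-1}B_N+D_N$, $A_N\in\mathbb{R}^{N\times N}$. Define $$A_{aug}=\begin{bmatrix}A&0_{n\times N}\\ B_NC&A_N\end{bmatrix},\qquad E_{aug}=\begin{bmatrix}E\\ 0_{N\times1}\end{bmatrix},\qquad C_{aug}=\begin{bmatrix}D_NC&C_N\end{bmatrix}.$$ It is assumed that $(A_{aug},C_{aug})$ is observable and $(A_{aug},E_{aug})$ is controllable. ''Disjoint'' means that no two of the three spectra share an element. *)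

(* Defs.v *)
From HB Require Import structures.
From mathcomp Require Import all_boot all_order all_algebra.
From mathcomp Require Import complex reals.

Set Implicit Arguments.
Unset Strict Implicit.
Unset Printing Implicit Defensive.

Import Order.TTheory GRing.Theory Num.Theory.
Local Open Scope ring_scope.

(* Kalman's rank conditions: column j of the controllability matrix is A^j B,
   row i of the observability matrix is C A^i. *)
Definition ctrb_mx {R : realType} n (A : 'M[R]_n) (B : 'cV[R]_n) : 'M[R]_n :=
  \matrix_(i, j) (A ^+ j *m B) i 0.

Definition obsv_mx {R : realType} n (A : 'M[R]_n) (C : 'rV[R]_n) : 'M[R]_n :=
  \matrix_(i, j) (C *m A ^+ i) 0 j.

Definition controllable {R : realType} n (A : 'M[R]_n) (B : 'cV[R]_n) : Prop :=
  \rank (ctrb_mx A B) = n.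

Definition observable {R : realType} n (A : 'M[R]_n) (C : 'rV[R]_n) : Prop :=
  \rank (obsv_mx A C) = n.

(* Complex eigenvalues of a real matrix, listed with algebraic multiplicity;
   the order of the list is arbitrary. *)
Definition spectrum {R : realType} n (A : 'M[R]_n) : seq R[i] :=
  sval (closed_field_poly_normal (char_poly (map_mx (real_complex R) A))).

Lemma char_poly_spectrum {R : realType} n (A : 'M[R]_n) :
  char_poly (map_mx (real_complex R) A) =
  \prod_(z <- spectrum A) ('X - z%:P).
Proof.
rewrite /spectrum; case: closed_field_poly_normal => s /= {1}->.
by rewrite (monicP (char_poly_monic _)) scale1r.
Qed.

Lemma size_spectrum {R : realType} n (A : 'M[R]_n) : size (spectrum A) = n.
Proof.
have := size_char_poly (map_mx (real_complex R) A).
by rewrite char_poly_spectrum size_prod_XsubC => -[].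
Qed.

Lemma mem_spectrum {R : realType} n (A : 'M[R]_n) (z : R[i]) :
  (z \in spectrum A) = eigenvalue (map_mx (real_complex R) A) z.
Proof.
by rewrite eigenvalue_root_char char_poly_spectrum root_prod_XsubC.
Qed.

Definition disjoint_spectra {R : realType} m n
    (A : 'M[R]_m) (B : 'M[R]_n) : Prop :=
  forall z : R[i], ~ (z \in spectrum A /\ z \in spectrum B).

(* Rational functions are elements of {fraction {poly R}}, the indeterminate s
   being tofrac 'X; there s I - A is invertible, so invmx is its inverse. *)
Definition ratC {R : realType} (c : R) : {fraction {poly R}} := tofrac c%:P.

Definition transfer {R : realType} m (A : 'M[R]_m) (B : 'cV[R]_m)
    (C : 'rV[R]_m) (D : R) : {fraction {poly R}} :=
  (map_mx ratC C *m invmx ((tofrac 'X)%:M - map_mx ratC A) *m map_mx ratC B) 0 0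
  + ratC D.

Definition minimal_realization {R : realType} (P : {fraction {poly R}}) m
    (A : 'M[R]_m) (B : 'cV[R]_m) (C : 'rV[R]_m) (D : R) : Prop :=
  transfer A B C D = P /\
  forall k (A' : 'M[R]_k) (B' : 'cV[R]_k) (C' : 'rV[R]_k) (D' : R),
    transfer A' B' C' D' = P -> (m <= k)%N.

Definition pade_den {R : realType} (tau : R) (N : nat) : {poly R} :=
  \poly_(k < N.+1)
    (((2 * N - k)`! * N`!)%N%:R / ((2 * N)`! * k`! * (N - k)`!)%N%:R
     * tau ^+ k).

Definition pade {R : realType} (tau : R) (N : nat) : {fraction {poly R}} :=
  tofrac (pade_den tau N \Po (- 'X)) / tofrac (pade_den tau N).

Definition A_aug {R : realType} n N (A : 'M[R]_n) (C : 'rV[R]_n)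
    (AN : 'M[R]_N) (BN : 'cV[R]_N) : 'M[R]_(n + N) :=
  block_mx A 0 (BN *m C) AN.

Definition E_aug {R : realType} n N (E : 'cV[R]_n) : 'cV[R]_(n + N) :=
  col_mx E 0.

Definition C_aug {R : realType} n N (C : 'rV[R]_n)
    (CN : 'rV[R]_N) (DN : R) : 'rV[R]_(n + N) :=
  row_mx (DN *: C) CN.

Definition posdef {R : realType} n (S : 'M[R]_n) : Prop :=
  S^T = S /\ forall x : 'cV[R]_n, x != 0 -> 0 < (x^T *m S *m x) 0 0.

(* Filter Riccati equation with scalar disturbance intensity V and scalar
   measurement noise intensity W. *)
Definition riccati {R : realType} n (A : 'M[R]_n) (E : 'cV[R]_n)
    (C : 'rV[R]_n) (V W : R) (S : 'M[R]_n) : Prop :=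
  0 = A *m S + S *m A^T + V *: (E *m E^T)
      - W^-1 *: (S *m C^T *m C *m S).

Definition est_gain {R : realType} n (S : 'M[R]_n) (C : 'rV[R]_n) (W : R) :
    'cV[R]_n :=
  W^-1 *: (S *m C^T).

(* Main.v *)
Require Import Defs.
From mathcomp Require Import all_boot all_order all_algebra.
From mathcomp Require Import complex reals.
From mathcomp Require Import ring lra zify.

Import Order.TTheory GRing.Theory Num.Theory.
Local Open Scope ring_scope.

Set Implicit Arguments.
Unset Strict Implicit.

(** The closed-loop polynomial of a Riccati estimator is a spectral factor.
    Write p~(s) = p(-s), let a be the characteristic polynomial of A, p that
    of A - L C, and c the numerator of C (s - A)^-1 E over a.  The Riccati
    equation gives
      W p p~ = W a a~ + V c c~                  (riccati_spectral_identity).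
    For the augmented system, a is replaced by a aN, with aN the
    characteristic polynomial of AN, and c by aN~ c, because the Pade
    approximant is allpass: PN = aN~ / aN (pade_realization,
    resolvent_num_aug).  The right-hand side is thereby multiplied by
    aN aN~, so the augmented closed-loop polynomial p' satisfies
    p' p'~ = (aN p) (aN p)~.

    Both p' and aN p have all their roots in the open left half plane, and a
    monic polynomial with this property is determined by its product with its
    reflection (hurwitz_factor_unique); hence p' = aN p, which is the claim
    with multiplicities.

    Stability of p and p' is the Lyapunov argument, with observability
    excluding imaginary eigenvalues (riccati_hurwitz).
    Stability of aN amounts to that of the Pade denominator, a rescaled
    reverse Bessel polynomial.  Those satisfy a three-term recurrence
    q_(k+2) = c_k q_(k+1) + z^2 q_k with c_k > 0, which preserves the
    positivity of the real part of q_(k+1) / (z q_k) on the closed right half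
    plane minus the origin (right_half_plane_step, bessel_hurwitz).  The
    stability of the denominator also makes the Pade fraction irreducible,
    which is what identifies the denominator with aN up to a constant. *)

(** * The spectral identity of the Riccati equation *)

(** Both sides are determinants of the bordered matrix with blocks M, -L, C
    and 1, after clearing C by columns or, up to the factor det M, by rows. *)
Lemma det_add_rank1 {T : idomainType} {n : nat} (M : 'M[T]_n)
    (L : 'cV[T]_n) (C : 'rV[T]_n) :
  \det M != 0 -> \det (M + L *m C) = \det M + (C *m \adj M *m L) 0 0.
Proof.
move=> M0.
pose K := block_mx M (- L) C (1%:M : 'M_1).
have detK : \det K = \det (M + L *m C).
  have /(congr1 determinant) : K *m block_mx 1%:M 0 (- C) 1%:M
      = block_mx (M + L *m C) (- L) 0 1%:M.
    rewrite /K mulmx_block !(mulmx0, mulmx1, mul1mx, add0r, addr0) subrr.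
    by rewrite mulNmx mulmxN opprK.
  by rewrite det_mulmx det_lblock det_ublock !det1 !mulr1.
have /(congr1 determinant) :
    block_mx 1%:M 0 (- (C *m \adj M)) (\det M)%:M *m K
    = block_mx M (- L) 0 ((\det M)%:M + C *m \adj M *m L).
  rewrite /K mulmx_block !(mulmx0, mul0mx, mulmx1, mul1mx, add0r, addr0).
  rewrite !mulNmx mulmxN opprK -!mulmxA mul_adj_mx mul_mx_scalar mul_scalar_mx.
  by rewrite addNr mulmxA [X in block_mx _ _ _ X]addrC.
rewrite det_mulmx det_lblock det_ublock det1 mul1r det_scalar1 detK.
by move/(mulfI M0); rewrite det_mx11 !mxE eqxx mulr1n.
Qed.

(** The equation is multiplied by C adj(M) on the left and adj(M')^T C^T on
    the right: on the left-hand side adj(M) M = det M and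
    M'^T adj(M')^T = det M' leave two terms linear in S C^T and C S, and on
    the right-hand side each rank-one matrix becomes a product of two
    scalars.  In the application M is s - A and M' is -s - A. *)
Lemma return_difference {T : comNzRingType} {n : nat} (M M' S : 'M[T]_n)
    (E L : 'cV[T]_n) (C : 'rV[T]_n) (v w : T) :
  M *m S + S *m M'^T = v *: (E *m E^T) - w *: (L *m L^T) ->
  S *m C^T = w *: L -> C *m S = w *: L^T ->
  w * (\det M + (C *m \adj M *m L) 0 0) * (\det M' + (C *m \adj M' *m L) 0 0)
  = w * \det M * \det M'
    + v * (C *m \adj M *m E) 0 0 * (C *m \adj M' *m E) 0 0.
Proof.
move=> lyap SC CS.
have tr (F : 'cV[T]_n) : F^T *m (\adj M')^T *m C^T = (C *m \adj M' *m F)^T.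
  by rewrite !trmx_mul mulmxA.
have sq (F : 'cV[T]_n) : (C *m \adj M *m (F *m F^T) *m (\adj M')^T *m C^T) 0 0
    = (C *m \adj M *m F) 0 0 * (C *m \adj M' *m F) 0 0.
  rewrite mulmxA -(mulmxA _ _ (\adj M')^T) -(mulmxA _ _ C^T) tr.
  by rewrite [LHS]mxE big_ord1 !mxE.
have := congr1 (fun X => (C *m \adj M *m X *m (\adj M')^T *m C^T) 0 0) lyap.
rewrite /= !(mulmxDr, mulmxDl) mulmxN !mulNmx -!(scalemxAr, scalemxAl).
rewrite !(mulmxA _ M S) -(mulmxA C) mul_adj_mx mul_mx_scalar.
rewrite -!scalemxAl CS -!scalemxAl tr.
rewrite -(mulmxA _ (S *m M'^T)) -(mulmxA S) -trmx_mul mul_adj_mx.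
rewrite tr_scalar_mx mul_mx_scalar -(scalemxAr _ _ S).
rewrite -scalemxAl -(mulmxA _ S) SC.
rewrite -scalemxAr.
rewrite [LHS]mxE [RHS]mxE [X in _ = _ + X]mxE.
rewrite !(mxE scalemx_key) ?sq.
rewrite [(_^T) 0 0]mxE; set a := \det M; set a' := \det M'.
set l := (_ *m \adj M *m L) 0 0; set l' := (_ *m \adj M' *m L) 0 0 => eq_l.
have -> : w * (a + l) * (a' + l')
    = w * a * a' + (a * (w * l') + a' * (w * l)) + w * (l * l') by ring.
by rewrite eq_l; ring.
Qed.

(** C (s I - A)^-1 F multiplied by the characteristic polynomial of A. *)
Definition resolvent_num {R : realType} {n : nat} (A : 'M[R]_n) (C : 'rV[R]_n)
    (F : 'cV[R]_n) : {poly R} :=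
  (map_mx polyC C *m \adj (char_poly_mx A) *m map_mx polyC F) 0 0.

Lemma char_poly_feedback {R : realType} {n : nat} (A : 'M[R]_n)
    (C : 'rV[R]_n) (L : 'cV[R]_n) :
  char_poly (A - L *m C) = char_poly A + resolvent_num A C L.
Proof.
rewrite /char_poly /resolvent_num -det_add_rank1; last first.
  by rewrite -/(char_poly A) monic_neq0 ?char_poly_monic.
by rewrite /char_poly_mx map_mxB map_mxM opprB addrA (addrAC _ (- _)).
Qed.

(** In terms of the gain L, the quadratic term of the Riccati equation is
    W L L^T; the equation is then linear in S. *)
Lemma riccati_gainE {R : realType} {n : nat} (A S : 'M[R]_n) (E : 'cV[R]_n)
    (C : 'rV[R]_n) (V W : R) :
  W != 0 -> S^T = S -> riccati A E C V W S ->
  let L := est_gain S C W in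
  [/\ S *m C^T = W *: L, C *m S = W *: L^T
    & A *m S + S *m A^T = W *: (L *m L^T) - V *: (E *m E^T)].
Proof.
move=> W0 S_sym ricc L.
have SC : S *m C^T = W *: L by rewrite scalerA divff ?scale1r.
have CS : C *m S = W *: L^T by rewrite -linearZ /= -SC trmx_mul trmxK S_sym.
split=> //; have -> : W *: (L *m L^T) = W^-1 *: (S *m C^T *m C *m S).
  rewrite -(mulmxA _ C) CS SC -scalemxAl -scalemxAr !scalerA.
  by rewrite mulVf ?mul1r.
move: ricc; rewrite /riccati => /esym /eqP; rewrite subr_eq0 => /eqP <-.
by rewrite addrK.
Qed.

(** The two copies of s S cancel in (s - A) S + S (-s - A)^T, so the Riccati
    equation is an instance of the hypothesis of return_difference. *)
Lemma riccati_spectral_identity {R : realType} {n : nat} (A S : 'M[R]_n)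
    (E : 'cV[R]_n) (C : 'rV[R]_n) (V W : R) :
  W != 0 -> S^T = S -> riccati A E C V W S ->
  let p := char_poly (A - est_gain S C W *m C) in
  let a := char_poly A in
  let c := resolvent_num A C E in
  W%:P * p * (p \Po - 'X) = W%:P * a * (a \Po - 'X) + V%:P * c * (c \Po - 'X).
Proof.
move=> W0 S_sym ricc p a c; pose L := est_gain S C W.
have [SC CS lyap] := riccati_gainE W0 S_sym ricc.
pose M := char_poly_mx A; pose M' := map_mx (comp_poly (- 'X)) M.
have evC m k (F : 'M[R]_(m, k)) :
    map_mx (comp_poly (- 'X)) (map_mx polyC F) = map_mx polyC F.
  by apply/matrixP=> i j; rewrite !mxE comp_polyC.
have num_ev F : resolvent_num A C F \Po - 'X
    = (map_mx polyC C *m \adj M' *m map_mx polyC F) 0 0.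
  have -> : resolvent_num A C F \Po - 'X
      = (map_mx (comp_poly (- 'X))
           (map_mx polyC C *m \adj M *m map_mx polyC F)) 0 0.
    by rewrite [RHS]mxE.
  by rewrite !map_mxM /= map_mx_adj !evC.
have a_ev : a \Po - 'X = \det M' by rewrite det_map_mx.
have -> : p = \det M + resolvent_num A C L by rewrite /p char_poly_feedback.
rewrite comp_polyD -[\det M]/a a_ev !num_ev.
apply: (@return_difference _ _ M M' (map_mx polyC S)).
- have -> : M' = (- 'X)%:M - map_mx polyC A.
    by rewrite /M' map_mxB /= evC map_scalar_mx /= comp_polyX.
  rewrite linearB /= tr_scalar_mx mulmxBl mulmxBr mul_mx_scalar mul_scalar_mx.
  rewrite !map_trmx -!map_mxM -!(map_mxZ polyC).
  rewrite -map_mxB.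
  have -> : V *: (E *m E^T) - W *: (L *m L^T) = - (A *m S) - S *m A^T.
    by rewrite -opprD lyap opprB.
  rewrite map_mxB map_mxN.
  by rewrite scaleNr addrACA subrr add0r.
- by rewrite map_trmx -map_mxM SC map_mxZ.
- by rewrite map_trmx -map_mxM CS map_mxZ.
Qed.

(** * The augmented system and the allpass property *)

Lemma char_poly_aug {R : realType} {n N : nat} (A : 'M[R]_n) (C : 'rV[R]_n)
    (AN : 'M[R]_N) (BN : 'cV[R]_N) :
  char_poly (A_aug A C AN BN) = char_poly A * char_poly AN.
Proof.
rewrite /char_poly /char_poly_mx map_block_mx map_mx0 (scalar_mx_block n N).
by rewrite opp_block_mx add_block_mx oppr0 addr0 det_lblock.
Qed.

(** The cascade multiplies transfer functions.  To avoid inverting, the column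
    adj(s - A_aug) E_aug is identified as the solution of a linear system
    over the polynomials, solved block by block. *)
Lemma resolvent_num_aug {R : realType} {n N : nat} (A : 'M[R]_n) (C : 'rV[R]_n)
    (E : 'cV[R]_n) (AN : 'M[R]_N) (BN : 'cV[R]_N) (CN : 'rV[R]_N) (DN : R) :
  resolvent_num (A_aug A C AN BN) (C_aug C CN DN) (E_aug N E)
  = (DN%:P * char_poly AN + resolvent_num AN CN BN) * resolvent_num A C E.
Proof.
pose M := char_poly_mx A; pose K := char_poly_mx AN.
pose Ma := char_poly_mx (A_aug A C AN BN).
pose y := \adj M *m map_mx polyC E.
pose u := map_mx polyC C *m y; pose z := \adj K *m map_mx polyC BN *m u.
have MaE : Ma = block_mx M 0 (- map_mx polyC (BN *m C)) K.
  rewrite /Ma /char_poly_mx map_block_mx map_mx0 (scalar_mx_block n N).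
  by rewrite opp_block_mx add_block_mx oppr0 addr0 add0r.
have detMa : \det Ma = \det M * \det K by rewrite MaE det_lblock.
have sol : Ma *m col_mx (\det K *: y) z = \det Ma *: map_mx polyC (E_aug N E).
  rewrite MaE mul_block_col mul0mx addr0 map_col_mx map_mx0.
  rewrite scale_col_mx scaler0 -MaE; congr col_mx.
    by rewrite -scalemxAr mulmxA mul_mx_adj mul_scalar_mx scalerA mulrC -detMa.
  rewrite mulNmx -scalemxAr map_mxM /z !mulmxA mul_mx_adj mul_scalar_mx.
  by rewrite !scalemxAl addNr.
have adjE : \adj Ma *m map_mx polyC (E_aug N E) = col_mx (\det K *: y) z.
  have Ma0 : \det Ma != 0 by rewrite monic_neq0 ?char_poly_monic.
  have /matrixP eq_sol := congr1 (mulmx (\adj Ma)) sol.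
  apply/matrixP=> i j; apply: (mulfI Ma0); have := eq_sol i j.
  by rewrite mulmxA mul_adj_mx mul_scalar_mx -scalemxAr [LHS]mxE [RHS]mxE => ->.
rewrite {1}/resolvent_num -mulmxA adjE map_row_mx mul_row_col map_mxZ.
have -> : resolvent_num A C E = u 0 0 by rewrite /u mulmxA.
rewrite -scalemxAl -scalemxAr -/u /z; move: (u) => u'.
rewrite mxE 2![fun_of_matrix (_ *: _) _ _]mxE.
rewrite !mulmxA.
rewrite [X in _ + X]mxE big_ord1 -/(resolvent_num AN CN BN).
by rewrite mulrDl mulrA.
Qed.

Lemma transferE {R : realType} {n : nat} (A : 'M[R]_n) (B : 'cV[R]_n)
    (C : 'rV[R]_n) (D : R) :
  transfer A B C D
  = tofrac (D%:P * char_poly A + resolvent_num A C B) / tofrac (char_poly A).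
Proof.
have a0 : tofrac (char_poly A) != 0.
  by rewrite tofrac_eq0 monic_neq0 ?char_poly_monic.
have ratE m k (F : 'M[R]_(m, k)) :
    map_mx ratC F = map_mx (@tofrac _) (map_mx polyC F).
  by apply/matrixP=> i j; rewrite !mxE.
have sIA : (tofrac 'X)%:M - map_mx ratC A = map_mx (@tofrac _) (char_poly_mx A).
  by rewrite /char_poly_mx map_mxB map_scalar_mx ratE.
have detE : \det (map_mx (@tofrac _) (char_poly_mx A)) = tofrac (char_poly A).
  by rewrite det_map_mx.
have unitA : map_mx (@tofrac _) (char_poly_mx A) \in unitmx.
  by rewrite unitmxE unitfE detE.
rewrite /transfer sIA /invmx unitA detE -map_mx_adj !ratE.
rewrite -scalemxAr -scalemxAl -!map_mxM mxE [X in _ * X + _]mxE.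
rewrite tofracD mulrDl addrC mulrC; congr (_ + _).
by rewrite tofracM mulfK.
Qed.

(** If r / a = q~ / q with q and q~ coprime, then q divides a; as both have
    degree N they are proportional, and r, a are the same multiple of q~, q. *)
Lemma pade_realization {R : realType} {N : nat} (tau : R) (AN : 'M[R]_N)
    (BN : 'cV[R]_N) (CN : 'rV[R]_N) (DN : R) :
  let q := pade_den tau N in
  size q = N.+1 -> coprimep q (q \Po - 'X) ->
  transfer AN BN CN DN = pade tau N ->
  char_poly AN %| q /\
  DN%:P * char_poly AN + resolvent_num AN CN BN = char_poly AN \Po - 'X.
Proof.
move=> q size_q co_q; rewrite transferE /pade -/q => /eqP.
set a := char_poly AN; set r := _ + _.
have a0 : a != 0 by rewrite monic_neq0 ?char_poly_monic.
have q0 : q != 0 by rewrite -size_poly_gt0 size_q.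
rewrite eqr_div ?tofrac_eq0 // -!tofracM tofrac_eq => /eqP eq_rq.
have q_dvd_a : q %| a by rewrite -(Gauss_dvdpr _ co_q) -eq_rq dvdp_mull.
have q_eqp_a : q %= a by rewrite -dvdp_size_eqp // size_q size_char_poly.
have /eqpf_eq[c _ qE] := q_eqp_a.
split; first by move: q_eqp_a; rewrite /eqp => /andP[].
by apply: (mulIf q0); rewrite eq_rq qE comp_polyZ -!scalerAl -!scalerAr.
Qed.

(** * Stable polynomials *)

Definition hurwitz {R : realType} (p : {poly R}) : Prop :=
  forall z : R[i], root (map_poly (real_complex R) p) z -> complex.Re z < 0.

Lemma hurwitzM {R : realType} (p q : {poly R}) :
  hurwitz p -> hurwitz q -> hurwitz (p * q).
Proof. by move=> hp hq z; rewrite rmorphM rootM => /orP[/hp|/hq]. Qed.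

Lemma hurwitz_dvdp {R : realType} (p q : {poly R}) :
  p %| q -> hurwitz q -> hurwitz p.
Proof.
move=> pq hq z rz; apply: hq; move: rz; rewrite -!dvdp_XsubCl.
by move/dvdp_trans; apply; rewrite dvdp_map.
Qed.

Lemma hurwitz_coprime {R : realType} (p q : {poly R}) :
  hurwitz p -> hurwitz q -> coprimep p (q \Po - 'X).
Proof.
move=> hp hq; rewrite -(coprimep_map (real_complex R)).
apply: Pdiv.ClosedField.root_coprimep => z /hp z_lt0; apply/negP.
rewrite map_comp_poly rmorphN /= map_polyX horner_comp !hornerE => /hq.
by case: z z_lt0 => x y /= x0 Nx0; lra.
Qed.

(** Each of p and q is coprime to the reflection of the other, so each divides
    the other. *)
Lemma hurwitz_factor_unique {R : realType} (p q : {poly R}) :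
  p \is monic -> q \is monic -> hurwitz p -> hurwitz q ->
  p * (p \Po - 'X) = q * (q \Po - 'X) -> p = q.
Proof.
move=> mp mq hp hq eq_pq; apply/eqP; rewrite -eqp_monic // /eqp.
rewrite -(Gauss_dvdpl q (hurwitz_coprime hp hq)) -eq_pq dvdp_mulr //=.
by rewrite -(Gauss_dvdpl p (hurwitz_coprime hq hp)) eq_pq dvdp_mulr.
Qed.

(** * Stability of the estimator *)

(** The hypotheses say that u and v span an A-invariant space inside the
    kernel of C, on which every C A^k vanishes. *)
Lemma observable_eq0 {R : realType} {n : nat} (A : 'M[R]_n) (C : 'rV[R]_n)
    (u v : 'cV[R]_n) (c d : R) :
  observable A C -> A *m u = c *: v -> A *m v = d *: u ->
  C *m u = 0 -> C *m v = 0 -> u = 0.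
Proof.
move=> obsAC Au Av Cu Cv.
have powk k : C *m A ^+ k *m u = 0 /\ C *m A ^+ k *m v = 0.
  elim: k => [|k [IHu IHv]]; first by rewrite expr0 mulmx1.
  rewrite exprSr -mulmxE mulmxA -!(mulmxA _ A) Au Av -!scalemxAr.
  by rewrite IHu IHv !scaler0.
apply: trmx_inj; apply/eqP; rewrite trmx0.
rewrite -(mulmx_free_eq0 _ (B := (obsv_mx A C)^T)).
  rewrite -trmx_mul -trmx0; apply/eqP; congr trmx; apply/colP=> i.
  have [/matrixP /(_ 0 0) + _] := powk i; rewrite !mxE => zero.
  rewrite -[RHS]zero.
  by apply: eq_bigr => j _; rewrite !mxE.
by rewrite /row_free mxrank_tr; apply/eqP.
Qed.

Lemma posdef_row {R : realType} {n : nat} (S : 'M[R]_n) (x : 'rV[R]_n) :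
  posdef S -> 0 <= (x *m S *m x^T) 0 0 /\ (x != 0 -> 0 < (x *m S *m x^T) 0 0).
Proof.
move=> [_ posS]; have pos_x : x != 0 -> 0 < (x *m S *m x^T) 0 0.
  by move=> x0; have := posS x^T; rewrite trmxK trmx_eq0; apply.
split=> //; have [->|/pos_x/ltW//] := eqVneq x 0.
by rewrite !mul0mx mxE.
Qed.

(** Splitting a complex left eigenvector into its real and imaginary parts
    keeps the Lyapunov argument over the reals, where S is definite. *)
Lemma complex_eigenvector {R : realType} {n : nat} (A : 'M[R]_n) (z : R[i]) :
  root (map_poly (real_complex R) (char_poly A)) z ->
  exists x y : 'rV[R]_n,
    [/\ (x != 0) || (y != 0),
        x *m A = complex.Re z *: x - complex.Im z *: y
      & y *m A = complex.Im z *: x + complex.Re z *: y].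
Proof.
rewrite map_char_poly -eigenvalue_root_char => /eigenvalueP[w wA w0].
exists (map_mx (@complex.Re R) w), (map_mx (@complex.Im R) w); split.
- apply: contraNT w0; rewrite negb_or !negbK.
  move=> /andP[/eqP/rowP re0 /eqP/rowP im0].
  apply/eqP/rowP=> j; move: (re0 j) (im0 j); rewrite !mxE.
  by case: (w 0 j) => a b /= -> ->.
- apply/rowP=> j; move/rowP/(_ j)/(congr1 (@complex.Re R)): wA; rewrite !mxE.
  case: z => a b; case: (w 0 j) => c d /= <-; rewrite raddf_sum.
  apply: eq_bigr => k _.
  by rewrite !mxE; case: (w 0 k) => e f /=; rewrite mulr0 subr0.
- apply/rowP=> j; move/rowP/(_ j)/(congr1 (@complex.Im R)): wA; rewrite !mxE.
  case: z => a b; case: (w 0 j) => c d /=; rewrite addrC => <-.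
  rewrite raddf_sum; apply: eq_bigr => k _.
  by rewrite !mxE; case: (w 0 k) => e f /=; rewrite mulr0 add0r.
Qed.

(** Twice the quadratic form of (A - L C) S is that of its symmetrization,
    which is - V E E^T - W L L^T by the Riccati equation. *)
Lemma lyapunov_quadratic {R : realType} {n : nat} (A S : 'M[R]_n)
    (E L : 'cV[R]_n) (C u : 'rV[R]_n) (V W : R) :
  S^T = S -> C *m S = W *: L^T ->
  A *m S + S *m A^T = W *: (L *m L^T) - V *: (E *m E^T) ->
  2 * (u *m (A - L *m C) *m S *m u^T) 0 0
  = - (V * (u *m E) 0 0 ^+ 2) - W * (u *m L) 0 0 ^+ 2.
Proof.
move=> S_sym CS lyap; pose psi (X : 'M[R]_n) := (u *m X *m u^T) 0 0.
have psiD X Y : psi (X + Y) = psi X + psi Y.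
  by rewrite /psi mulmxDr mulmxDl mxE.
have psiZ c X : psi (c *: X) = c * psi X.
  by rewrite /psi -scalemxAr -scalemxAl mxE.
have psiN X : psi (- X) = - psi X by rewrite -scaleN1r psiZ mulN1r.
have psi_sq (F : 'cV[R]_n) : psi (F *m F^T) = (u *m F) 0 0 ^+ 2.
  rewrite /psi mulmxA -mulmxA -trmx_mul [LHS]mxE big_ord1.
  by rewrite [X in _ * X]mxE.
have psi_tr : psi (S *m A^T) = psi (A *m S).
  have -> : psi (A *m S) = ((u *m (A *m S) *m u^T)^T) 0 0 by rewrite [RHS]mxE.
  by rewrite /psi !trmx_mul trmxK S_sym !mulmxA.
have eq_u := congr1 psi lyap.
have -> : (u *m (A - L *m C) *m S *m u^T) 0 0
    = psi (A *m S - W *: (L *m L^T)).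
  by rewrite /psi -(mulmxA u) mulmxBl -(mulmxA L) CS -scalemxAr.
move: eq_u; rewrite !(psiD, psiN, psiZ) psi_tr !psi_sq; lra.
Qed.

(** Summing the Lyapunov form over the real and imaginary parts x, y of a left
    eigenvector with eigenvalue p + i q gives
    2 p (x S x^T + y S y^T)
      = - V ((x E)^2 + (y E)^2) - W ((x L)^2 + (y L)^2).
    If p were nonnegative, then p = 0, x L = y L = 0 and V x E = V y E = 0; the Riccati equation turns
    S x^T and S y^T into vectors spanning an A-invariant space in the kernel
    of C, contradicting observability. *)
Lemma riccati_hurwitz {R : realType} {n : nat} (A S : 'M[R]_n) (E : 'cV[R]_n)
    (C : 'rV[R]_n) (V W : R) :
  0 <= V -> 0 < W -> observable A C -> posdef S -> riccati A E C V W S ->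
  hurwitz (char_poly (A - est_gain S C W *m C)).
Proof.
move=> V0 W0 obsAC pdS ricc z /complex_eigenvector[x [y [xy0 xA yA]]].
have S_sym : S^T = S by case: pdS.
have [] := riccati_gainE (lt0r_neq0 W0) S_sym ricc.
move: (est_gain S C W) xA yA => L xA yA SC CS lyap.
set p := complex.Re z in xA yA *; set q := complex.Im z in xA yA.
pose form (u v : 'rV[R]_n) : R := (u *m S *m v^T) 0 0.
have formC u v : form u v = form v u.
  by rewrite /form -[in RHS]S_sym -[v in RHS]trmxK -!trmx_mul mulmxA [RHS]mxE.
have formL a b u v w : form (a *: u + b *: v) w = a * form u w + b * form v w.
  by rewrite /form !mulmxDl -!scalemxAl !mxE.
have quad u := lyapunov_quadratic u S_sym CS lyap.
have := quad x; have := quad y; rewrite xA yA -scaleNr -!/(form _ _) !formL.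
rewrite (formC y x); set xE := (x *m E) 0 0; set xL := (x *m L) 0 0.
set yE := (y *m E) 0 0; set yL := (y *m L) 0 0 => quad_y quad_x.
have [fx0 fx_gt0] := posdef_row x pdS.
have [fy0 fy_gt0] := posdef_row y pdS.
rewrite -!/(form _ _) in fx0 fx_gt0 fy0 fy_gt0.
have fxy : 0 < form x x + form y y by case/orP: xy0 => [/fx_gt0|/fy_gt0]; lra.
have trace : 2 * p * (form x x + form y y)
    = - (V * xE ^+ 2 + W * xL ^+ 2 + V * yE ^+ 2 + W * yL ^+ 2) by lra.
have sqV (a : R) : 0 <= V * a ^+ 2 by rewrite mulr_ge0 ?sqr_ge0.
have sqW (a : R) : 0 <= W * a ^+ 2 by rewrite mulr_ge0 ?sqr_ge0 ?ltW.
have [[VxE VyE] [WxL WyL]] := ((sqV xE, sqV yE), (sqW xL, sqW yL)).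
rewrite ltNge; apply/negP => p_ge0.
have p_form : 0 <= p * (form x x + form y y).
  by apply: mulr_ge0 => //; exact: ltW.
have zero (a b : R) : b != 0 -> b * a ^+ 2 = 0 -> a = 0.
  by move=> b0 /eqP; rewrite mulf_eq0 (negPf b0) expf_eq0 => /eqP.
have W_neq0 := lt0r_neq0 W0.
have xL0 : xL = 0 by apply: zero W_neq0 _; lra.
have yL0 : yL = 0 by apply: zero W_neq0 _; lra.
have xE0 : V * xE = 0.
  have /eqP : V * xE ^+ 2 = 0 by lra.
  by rewrite mulf_eq0 expf_eq0 /= -mulf_eq0 => /eqP.
have yE0 : V * yE = 0.
  have /eqP : V * yE ^+ 2 = 0 by lra.
  by rewrite mulf_eq0 expf_eq0 /= -mulf_eq0 => /eqP.
have p0 : p = 0.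
  have /eqP : p * (form x x + form y y) = 0 by lra.
  by rewrite mulf_eq0 (gt_eqF fxy) orbF => /eqP.
(* Both rank-one terms of the Riccati equation vanish on u^T, and u L = 0
   makes A and A - L C agree on u. *)
have dual (u : 'rV[R]_n) : (u *m L) 0 0 = 0 -> V * (u *m E) 0 0 = 0 ->
    A *m (S *m u^T) = - (S *m (u *m (A - L *m C))^T) /\ C *m (S *m u^T) = 0.
  move=> uL00 uE00.
  have uL : u *m L = 0 by rewrite [LHS]mx11_scalar uL00 raddf0.
  have uE : V *: (u *m E) = 0.
    by rewrite [u *m E]mx11_scalar scale_scalar_mx uE00 raddf0.
  have CSu : C *m (S *m u^T) = 0.
    by rewrite mulmxA CS -scalemxAl -trmx_mul uL trmx0 scaler0.
  split=> //; apply/eqP; rewrite -addr_eq0 mulmxBr (mulmxA u L) uL mul0mx subr0.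
  rewrite trmx_mul !mulmxA -mulmxDl lyap mulmxBl -!scalemxAl -!mulmxA.
  rewrite -!trmx_mul uL trmx0 mulmx0 scaler0 sub0r scalemxAr -linearZ /= uE.
  by rewrite trmx0 mulmx0 oppr0.
have [Ax Cx] := dual x xL0 xE0; have [Ay Cy] := dual y yL0 yE0.
move: Ax Ay; rewrite xA yA p0 !scale0r sub0r addr0.
rewrite -scaleNr !linearZ /= !scalerN -!scaleNr => Ax Ay.
have Sx0 := observable_eq0 obsAC Ax Ay Cx Cy.
have Sy0 := observable_eq0 obsAC Ay Ax Cy Cx.
by move: fxy; rewrite /form -!mulmxA Sx0 Sy0 !mulmx0 mxE addr0 ltxx.
Qed.

(** * Stability of the Pade denominator *)

(** The reverse Bessel polynomial of degree N at z / 2, times 2^N. *)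
Definition bessel (R : realType) (N : nat) : {poly R} :=
  \poly_(k < N.+1) ((2 * N - k)`!%:R / (k`! * (N - k)`!)%:R).

(** Compared at 'X^k, after division by the common factor
    (2 N + 2 - k)! / (k! (N + 2 - k)!), the identity reads
    (2N + 4 - k)(2N + 3 - k) = (4N + 6)(N + 2 - k) + k (k - 1). *)
Lemma bessel_rec (R : realType) (N : nat) :
  bessel R N.+2 = (4 * N + 6)%:R *: bessel R N.+1 + 'X^2 * bessel R N.
Proof.
have nz k : k`!%:R != 0 :> R by rewrite pnatr_eq0 -lt0n fact_gt0.
have nzS k : k.+1%:R != 0 :> R by rewrite pnatr_eq0.
apply/polyP=> k; rewrite coefD coefZ coefXnM !coef_poly.
case: ltnP => k_le; last first.
  rewrite ltnNge (ltnW k_le) /= mulr0 add0r ifF //; last by lia.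
  by rewrite ifF //; lia.
(* In top degree N + 2 only the second summand contributes. *)
have [->|k_lt] := eqVneq k N.+2.
  rewrite ltnn mulr0 add0r (_ : (N.+2 - 2 = N)%N) ?ltnSn /=; last by lia.
  rewrite (_ : (2 * N.+2 - N.+2 = N.+2)%N); last by lia.
  rewrite (_ : (2 * N - N = N)%N); last by lia.
  by rewrite !subnn !muln1 !divff.
have k_le1 : (k <= N.+1)%N by lia.
rewrite ltnS k_le1.
pose m := (N.+1 - k)%N.
have kE : N.+1 = (k + m)%N by rewrite /m; lia.
rewrite (_ : (N.+2 - k = m.+1)%N); last by lia.
rewrite -/m (_ : (2 * N.+2 - k = (2 * N.+1 - k).+2)%N); last by lia.
set F := (2 * N.+1 - k)%N.
have FE : F%:R = k%:R + 2 * m%:R :> R.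
  by rewrite /F kE -natrM -natrD; congr _%:R; lia.
have NE : (4 * N + 6)%:R = 4 * (k%:R + m%:R) + 2 :> R.
  by rewrite -natrD -kE -!natrM -natrD; congr _%:R; lia.
case: ltnP => [k_lt2|k_ge2].
  rewrite addr0 NE !factS !natrM -(natr1 F.+1) -(natr1 F) FE.
  (* Below degree 2 the second summand is absent and k (k - 1) = 0. *)
  have kk1 : k%:R * (k%:R - 1) = 0 :> R.
    by case: (k) k_lt2 => [|[|]] // _; rewrite ?mul0r ?subrr ?mulr0.
  have eq_c : (k%:R + 2 * m%:R + 1 + 1) * (k%:R + 2 * m%:R + 1)
      = (4 * (k%:R + m%:R) + 2) * (m%:R + 1) :> R.
    by apply/eqP; rewrite -subr_eq0 -kk1; apply/eqP; ring.
  have := nz k; have := nz m; have := nzS m; rewrite -(natr1 m) => m1 mf kf.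
  rewrite !mulrA eq_c; by field; rewrite m1 mf kf.
have jE : k = (k - 2).+2 by lia.
set j := (k - 2)%N in jE *.
rewrite ifT; last by lia.
rewrite (_ : (N - j = m.+1)%N); last by lia.
rewrite (_ : (2 * N - j = F)%N); last by lia.
rewrite NE jE !factS !natrM -(natr1 F.+1) -(natr1 F) FE jE.
have := nz j; have := nz m; have := nzS m; have := nzS j; have := nzS j.+1.
rewrite -!natr1 => j2 j1 m1 mf jf.
by field; rewrite mf m1 jf j1 j2.
Qed.

Lemma sqr_Re_Im_gt0 {R : realType} (z : R[i]) :
  z != 0 -> 0 < complex.Re z ^+ 2 + complex.Im z ^+ 2.
Proof.
move=> z0; rewrite lt_neqAle addr_ge0 ?sqr_ge0 // andbT eq_sym.
apply: contraNneq z0 => /eqP.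
rewrite paddr_eq0 ?sqr_ge0 // !expf_eq0 /= => /andP[/eqP re0 /eqP im0].
by rewrite [z]complexE re0 im0 mulr0 addr0.
Qed.

(** With r = u / (z v), the quotient (c u + z^2 v) / (z u) is c / z + 1 / r;
    inversion preserves the right half plane.  Positivity of Re (a / b) is
    stated as that of Re (a b^* ) so that nothing has to be nonzero. *)
Lemma right_half_plane_step {R : realType} (z u v : R[i]) (c : R) :
  0 <= c -> 0 <= complex.Re z -> z != 0 ->
  0 < complex.Re (u * (z * v)^*%C) ->
  0 < complex.Re (((real_complex R c) * u + z ^+ 2 * v) * (z * u)^*%C).
Proof.
move=> c0 z_re z0 uv.
have norm_z := sqr_Re_Im_gt0 z0.
have -> : complex.Re ((real_complex R c * u + z ^+ 2 * v) * (z * u)^*%C)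
    = c * complex.Re z * (complex.Re u ^+ 2 + complex.Im u ^+ 2)
      + (complex.Re z ^+ 2 + complex.Im z ^+ 2) * complex.Re (u * (z * v)^*%C).
  case: z {z_re z0 uv norm_z} => a b.
  by case: u => d e; case: v => f g /=; ring.
by rewrite ltr_wpDl ?mulr_gt0 // mulr_ge0 ?addr_ge0 ?sqr_ge0 // mulr_ge0.
Qed.

(** At z = 0 the value is the constant coefficient; elsewhere in the closed
    right half plane the recurrence keeps Re (h_(k+1) (z h_k)^* ) positive,
    which forces h_(k+1) to be nonzero. *)
Lemma bessel_hurwitz (R : realType) (N : nat) : hurwitz (bessel R N).
Proof.
move=> z rz; rewrite ltNge; apply/negP => z_re.
pose h k := (map_poly (real_complex R) (bessel R k)).[z].
have h0 : h 0%N = 1.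
  rewrite /h (_ : bessel R 0 = 1) ?rmorph1 ?hornerC //.
  by rewrite /bessel poly_def big_ord1 muln0 subn0 muln1 divr1 scale1r.
have h1 : h 1%N = 2 + z.
  rewrite /h (_ : bessel R 1 = 2%:P + 'X).
    by rewrite rmorphD /= map_polyC map_polyX /= !hornerE rmorphMn.
  by apply/polyP=> -[|[|k]]; rewrite !coefE //= ?add0r ?addr0 ?divr1.
have hS k : h k.+2 = real_complex R (4 * k + 6)%:R * h k.+1 + z ^+ 2 * h k.
  by rewrite /h bessel_rec rmorphD rmorphM /= map_polyZ map_polyXn /= !hornerE.
have [z0|z0] := eqVneq z 0.
  move: rz; rewrite z0 -(rmorph0 (real_complex R)).
  rewrite fmorph_root /root horner_coef0.
  rewrite coef_poly /= subn0 mulf_eq0 invr_eq0 !pnatr_eq0.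
  by rewrite muln_eq0 !(gtn_eqF (fact_gt0 _)).
have pos k : 0 < complex.Re (h k.+1 * (z * h k)^*%C).
  elim: k => [|k IHk]; last by rewrite hS right_half_plane_step ?ler0n.
  rewrite h0 h1 mulr1.
  have -> : complex.Re ((2 + z) * z^*%C)
      = 2 * complex.Re z + (complex.Re z ^+ 2 + complex.Im z ^+ 2).
    by case: (z) => a b /=; ring.
  by rewrite ltr_wpDl ?sqr_Re_Im_gt0 // mulr_ge0.
case: N rz => [|k] /rootP; rewrite -/(h _) => hz.
  by move/eqP: hz; rewrite h0 oner_eq0.
by have := pos k; rewrite hz mul0r ltxx.
Qed.

Lemma pade_den_bessel {R : realType} (tau : R) (N : nat) :
  pade_den tau N = (N`!%:R / (2 * N)`!%:R) *: (bessel R N \Po (tau *: 'X)).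
Proof.
rewrite /pade_den /bessel !poly_def raddf_sum scaler_sumr.
apply: eq_bigr => k _ /=.
rewrite comp_polyZ comp_Xn_poly exprZn !scalerA; congr (_ *: _).
rewrite !natrM.
by field; rewrite !pnatr_eq0 -!lt0n !fact_gt0.
Qed.

Lemma size_pade_den {R : realType} (tau : R) (N : nat) :
  0 < tau -> size (pade_den tau N) = N.+1.
Proof.
move=> tau0; rewrite size_poly_eq //= mulf_neq0 ?expf_neq0 ?gt_eqF //.
by rewrite divr_gt0 // ltr0n ?muln_gt0 !fact_gt0.
Qed.

Lemma pade_den_hurwitz {R : realType} (tau : R) (N : nat) :
  0 < tau -> hurwitz (pade_den tau N).
Proof.
move=> tau0 z; rewrite pade_den_bessel map_polyZ rootZ; last first.
  rewrite fmorph_eq0 mulf_neq0 ?invr_eq0 ?pnatr_eq0 -?lt0n ?fact_gt0 //.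
rewrite map_comp_poly map_polyZ map_polyX /root horner_comp !hornerE.
by move/bessel_hurwitz; case: z => a b /=; rewrite mul0r subr0 pmulr_rlt0.
Qed.

Theorem mainTheorem5 (R : realType) (n N : nat) (tau : R)
  (A : 'M[R]_n) (B E : 'cV[R]_n) (C : 'rV[R]_n) (V W : R)
  (AN : 'M[R]_N) (BN : 'cV[R]_N) (CN : 'rV[R]_N) (DN : R)
  (Sigma : 'M[R]_n) (Sigma_aug : 'M[R]_(n + N)) :
  (1 <= n)%N -> (1 <= N)%N -> 0 < tau -> 0 <= V -> 0 < W ->
  observable A C -> controllable A B -> controllable A E ->
  minimal_realization (pade tau N) AN BN CN DN ->
  let Aa := A_aug A C AN BN in
  let Ea := E_aug N E in
  let Ca := C_aug C CN DN in
  observable Aa Ca -> controllable Aa Ea ->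
  posdef Sigma_aug -> riccati Aa Ea Ca V W Sigma_aug ->
  posdef Sigma -> riccati A E C V W Sigma ->
  let L_aug := est_gain Sigma_aug Ca W in
  let A_aug_CL := Aa - L_aug *m Ca in
  let L := est_gain Sigma C W in
  disjoint_spectra AN A ->
  disjoint_spectra AN (A - L *m C) ->
  disjoint_spectra A (A - L *m C) ->
  perm_eq (spectrum A_aug_CL) (spectrum AN ++ spectrum (A - L *m C)).
Proof.
move=> _ _ tau0 V0 W0 obsAC _ _ [trP _] Aa Ea Ca obsAa _ pdSa riccSa pdS riccS.
move=> L_aug A_aug_CL L _ _ _.
have hur_q := pade_den_hurwitz (N := N) tau0.
have [AN_q num_AN] := pade_realization (size_pade_den N tau0)
  (hurwitz_coprime hur_q hur_q) trP.
have hur_AN : hurwitz (char_poly AN) by apply: hurwitz_dvdp hur_q.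
have hur_CL := riccati_hurwitz V0 W0 obsAC pdS riccS.
have hur_aug := riccati_hurwitz V0 W0 obsAa pdSa riccSa.
have W_neq0 := lt0r_neq0 W0.
have id_CL := riccati_spectral_identity W_neq0 (proj1 pdS) riccS.
have id_aug := riccati_spectral_identity W_neq0 (proj1 pdSa) riccSa.
have factor : char_poly A_aug_CL = char_poly AN * char_poly (A - L *m C).
  apply: hurwitz_factor_unique; rewrite ?rpredM ?char_poly_monic //.
    exact: hurwitzM.
  have WP0 : W%:P != 0 :> {poly R} by rewrite polyC_eq0.
  apply: (mulfI WP0); rewrite mulrA id_aug char_poly_aug.
  rewrite resolvent_num_aug num_AN.
  set aN := char_poly AN in id_CL *; set a := char_poly A in id_CL *.
  set c := resolvent_num A C E in id_CL *.
  have refl_refl : (aN \Po - 'X) \Po - 'X = aN.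
    by rewrite -comp_polyA raddfN /= comp_polyX opprK comp_polyXr.
  rewrite !comp_polyM refl_refl.
  transitivity (aN * (aN \Po - 'X)
      * (W%:P * a * (a \Po - 'X) + V%:P * c * (c \Po - 'X))).
    by ring.
  by rewrite -id_CL; ring.
apply: prod_XsubC_eq; rewrite big_cat -!char_poly_spectrum -!map_char_poly.
by rewrite factor rmorphM.
Qed.
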